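(* Let $k\ge 10$ and let $p$ be a prime. (i) If $p$ is odd and $p$ divides $k$, then there is a finite group $H$ with an elementary abelian $p$-subgroup $1\ne M\trianglelefteq H$ such that $H/M\cong A_k$, the extension $1\to M\to H\to A_k\to 1$ is nonsplit, and $H$ has a faithful permutation representation of degree $\frac12 pk(k-1)$. (ii) There is a finite group $H$ with an elementary abelian $2$-subgroup $1\ne M\trianglelefteq H$ such that $H/M\cong A_k$, the extension $1\to M\to H\to A_k\to 1$ is nonsplit, and $H$ has a faithful transitive permutation representation of degree $2k(k-1)$.
   Context: An extension $1\to M\to H\to A_k\to 1$ is nonsplit if $M$ has no complement in $H$. *)

(* Defs.v *)
From mathcomp Require Import all_boot all_fingroup all_solvable.
Set Implicit Arguments. Unset Strict Implicit. Unset Printing Implicit Defensive.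
Open Scope group_scope.

Definition faithful_perm_rep (gT : finGroupType) (H : {group gT}) (n : nat) : Prop :=
  exists f : {morphism H >-> {perm 'I_n}}, 'injm f.

Definition faithful_transitive_perm_rep (gT : finGroupType) (H : {group gT}) (n : nat) : Prop :=
  exists f : {morphism H >-> {perm 'I_n}},
    'injm f /\ [transitive f @* H, on [set: 'I_n] | 'P].

(* Main.v *)
(** Inside the group of pairs [(v, g)], with [v] an [F_p]-valued function on
    ordered pairs of distinct points and [g] a permutation, acting on pairs decorated by
    an element of [F_p], a non-trivial class of H^1(A_k, P/M), for a submodule
    [M] of the module [P] of such functions, pulls back to an extension of
    [A_k] by [M]. In (i), [P] consists of the antisymmetric functions, [M] of
    those with zero row sums, and the class is that of [g |-> g e - e] for a
    basis vector [e]; the points [(i, j, x)] and [(j, i, - x)] are identified.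
    In (ii), [p = 2], [P] consists of all functions, [M] of the symmetric ones,
    and the class records which unordered pairs are reversed by [g].
    Non-splitness is seen on one element: a product of [k / p] disjoint
    [p]-cycles in (i), and [(0 1)(2 3)] in (ii), has no lift of the same
    order. *)
Require Import Defs.
From HB Require Import structures.
From mathcomp Require Import all_boot all_fingroup all_solvable all_algebra.
Import GRing.Theory.
Set Implicit Arguments. Unset Strict Implicit. Unset Printing Implicit Defensive.
Open Scope group_scope.

(** A complement [K] contains an element [y] of the kernel coset of [x], and [y ^+ n] lies in both
    [K] and the kernel. Used contrapositively to refute splitting. *)
Lemma splits_ker_lift (aT rT : finGroupType) (H : {group aT})
    (f : {morphism [set: aT] >-> rT}) (x : aT) (n : nat) :
  [splits H, over 'ker_H f] -> x \in H -> f x ^+ n = 1 ->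
  exists y, [/\ y \in H, f y = f x & y ^+ n = 1].
Proof.
case/splitsP=> K /complP[tiK defH] Hx fxn.
have: x \in 'ker_H f * K by rewrite defH.
case/mulsgP=> u y /setIP[_ /kerP fu] Ky xE.
have fy : f y = f x by rewrite xE morphM ?inE // fu ?inE // mul1g.
have HK : K \subset H by rewrite -defH mulG_subr.
exists y; split => //; first exact: (subsetP HK).
have Hyn : y ^+ n \in H by rewrite groupX ?(subsetP HK).
apply/set1gP; rewrite -tiK; apply/setIP; split; last exact: groupX.
apply/setIP; split=> //.
by apply/kerP; rewrite ?inE // morphX ?inE // fy.
Qed.

(** * Permutation representations from actions on a finite set *)

Section PermRepOfAction.

Variables (gT : finGroupType) (rT : finType) (to : {action gT &-> rT}).
Variables (H : {group gT}) (S : {set rT}).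
Hypothesis actsH : [acts H, on S | to].
Hypothesis faithH : [faithful H, on S | to].

Let toS (i : 'I_#|S|) (h : gT) : 'I_#|S| :=
  enum_rank_in (enum_valP i) (to (enum_val i) h).

Let toSE i h : h \in H -> enum_val (toS i h) = to (enum_val i) h.
Proof.
by move=> Hh; rewrite enum_rankK_in // (acts_act actsH) // enum_valP.
Qed.

(** Outside [H] a point may leave [S]; the identity is used there so that every [h] yields a
    permutation. *)
Let toS_inj h : injective (fun i => if h \in H then toS i h else i).
Proof.
move=> i j; case: ifP => // Hh /(congr1 enum_val).
by rewrite !toSE // => /act_inj/enum_val_inj.
Qed.

Let rep h := perm (@toS_inj h).

Let repE i h : h \in H -> enum_val (rep h i) = to (enum_val i) h.
Proof. by move=> Hh; rewrite permE Hh toSE. Qed.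

Let repM : {in H &, {morph rep : x y / x * y}}.
Proof.
move=> x y Hx Hy; apply/permP=> i; apply: enum_val_inj.
by rewrite permM !repE ?groupM // actM.
Qed.

Let repm := Morphism repM.

Let injm_rep : 'injm repm.
Proof.
apply/subsetP=> h /setIP[Hh]; rewrite inE => /set1gP rh1.
apply: (subsetP faithH); rewrite inE Hh.
apply/astabP=> x Sx.
have := repE (enum_rank_in Sx x) Hh.
by rewrite -[rep h]/(repm h) rh1 perm1 enum_rankK_in.
Qed.

Lemma faithful_perm_rep_action : faithful_perm_rep H #|S|.
Proof. by exists repm. Qed.

Lemma faithful_transitive_perm_rep_action :
  [transitive H, on S | to] -> faithful_transitive_perm_rep H #|S|.
Proof.
move=> trH; exists repm; split=> //.
have [x Sx _] := imsetP trH.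
apply/imsetP; exists (enum_rank_in Sx x); rewrite ?inE //.
apply/setP=> i; rewrite inE; apply/esym/imsetP.
have [h Hh hx] := atransP2 trH Sx (enum_valP i).
exists (repm h); first by rewrite mem_morphim.
by apply: enum_val_inj; rewrite /= apermE repE // enum_rankK_in.
Qed.

End PermRepOfAction.

(** * The ambient group and its action on decorated pairs *)

Section TwistedPairGroup.

Variables (A : finZmodType) (T : finType).
Implicit Types (v w : {ffun T * T -> A}) (g h : {perm T}).

(* [(v, g)] stands for the permutation
   [((i, j), x) |-> ((g i, g j), x + v (i, j))] of [T * T * A]. *)
Definition pair_wr : Type := ({ffun T * T -> A} * {perm T})%type.

HB.instance Definition _ := Finite.on pair_wr.

Definition pair_wr_mul (a b : pair_wr) : pair_wr :=
  ([ffun z => a.1 z + b.1 (a.2 z.1, a.2 z.2)]%R, a.2 * b.2).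

Definition pair_wr_one : pair_wr := ([ffun _ => 0%R], 1).

Definition pair_wr_inv (a : pair_wr) : pair_wr :=
  ([ffun z => - a.1 ((a.2^-1)%g z.1, (a.2^-1)%g z.2)]%R, a.2^-1).

Fact pair_wr_mulA : associative pair_wr_mul.
Proof.
move=> a b c; congr pair; last by rewrite mulgA.
by apply/ffunP=> z; rewrite !ffunE !permM addrA.
Qed.

Fact pair_wr_mul1 : left_id pair_wr_one pair_wr_mul.
Proof.
case=> v g; congr pair; last by rewrite mul1g.
by apply/ffunP=> -[i j]; rewrite !ffunE !perm1 add0r.
Qed.

Fact pair_wr_mulV : left_inverse pair_wr_one pair_wr_inv pair_wr_mul.
Proof.
case=> v g; congr pair; last by rewrite mulVg.
by apply/ffunP=> -[i j]; rewrite !ffunE addNr.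
Qed.

HB.instance Definition _ :=
  Finite_isGroup.Build pair_wr pair_wr_mulA pair_wr_mul1 pair_wr_mulV.

Lemma pair_wrME (a b : pair_wr) (z : T * T) :
  (a * b).1 z = (a.1 z + b.1 (a.2 z.1, a.2 z.2))%R.
Proof. by rewrite /= ffunE. Qed.

(** Turns [a ^+ n = 1] into the vanishing of sums of [a.1] along the walks of [a.2] on pairs. *)
Lemma pair_wrXE (a : pair_wr) (n : nat) (i j : T) :
  (a ^+ n).1 (i, j) =
    (\sum_(m < n) a.1 ((a.2 ^+ m)%g i, (a.2 ^+ m)%g j))%R.
Proof.
elim: n i j => [|n IHn] i j; first by rewrite big_ord0 /= ffunE.
rewrite expgS pair_wrME IHn big_ord_recl /= !perm1; congr (_ + _)%R.
by apply: eq_bigr => m _; rewrite /= !expgS !permM.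
Qed.

Definition pair_wr_proj (a : pair_wr) : {perm T} := a.2.

Fact pair_wr_projM :
  {in [set: pair_wr] &, {morph pair_wr_proj : a b / a * b}}.
Proof. by []. Qed.

Canonical pair_wr_proj_morphism := Morphism pair_wr_projM.

Definition pair_wr_act (z : T * T * A) (a : pair_wr) : T * T * A :=
  ((a.2 z.1.1, a.2 z.1.2), z.2 + a.1 z.1)%R.

Fact pair_wr_act1 : pair_wr_act^~ 1 =1 id.
Proof.
by case=> -[i j] x; rewrite /pair_wr_act /= !perm1 ffunE addr0.
Qed.

Fact pair_wr_actM z : act_morph pair_wr_act z.
Proof.
by case: z => -[i j] x a b; rewrite /pair_wr_act pair_wrME /= !permM addrA.
Qed.

Canonical pair_wr_action := TotalAction pair_wr_act1 pair_wr_actM.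

Lemma pair_wr_act_fix (a : pair_wr) (i j : T) (x : A) :
  pair_wr_act (i, j, x) a = (i, j, x) ->
  [/\ a.2 i = i, a.2 j = j & a.1 (i, j) = 0%R].
Proof.
by case=> ai aj ax; split=> //; apply: (@addrI _ x); rewrite addr0.
Qed.

End TwistedPairGroup.

(** * Kernel and image of the projection to permutations *)

Section ElementaryKernel.

Variables (p : nat) (T : finType) (H : {group pair_wr 'F_p T}).
Hypothesis p_pr : prime p.

Let projm := pair_wr_proj_morphism 'F_p T.

Lemma pair_wr_kerP (a : pair_wr 'F_p T) :
  reflect (a \in H /\ a.2 = 1) (a \in 'ker_H projm).
Proof.
apply: (iffP setIP) => -[Ha].
  by move=> /kerP => /(_ (in_setT _)).
by move=> a1; split=> //; apply/kerP; rewrite ?inE.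
Qed.

(** Over the identity permutation the product is pointwise addition of functions, and the [p]-th
    power is multiplication by [p = 0]. *)
Lemma pair_wr_ker_abelem : p.-abelem ('ker_H projm).
Proof.
apply/(abelemP p_pr); split.
  apply/centsP=> a /pair_wr_kerP[_ a1] b /pair_wr_kerP[_ b1].
  apply: injective_projections; last by rewrite /= a1 b1.
  by apply/ffunP=> -[i j]; rewrite !pair_wrME a1 b1 !perm1 /= addrC.
move=> a /pair_wr_kerP[_ a1]; apply: injective_projections; last first.
  by rewrite -[LHS]/(projm (a ^+ p)) morphX ?inE //= /pair_wr_proj a1 expg1n.
apply/ffunP=> -[i j]; rewrite pair_wrXE a1.
under eq_bigr do rewrite expg1n !perm1.
by rewrite sumr_const card_ord -mulr_natr pchar_Fp_0 // mulr0 ffunE.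
Qed.

Lemma pair_wr_ker_normal : 'ker_H projm <| H.
Proof. by rewrite (normalGI _ (ker_normal projm)) ?subsetT. Qed.

Lemma pair_wr_quotient_isog (G : {set {perm T}}) :
  (forall a, a \in H -> a.2 \in G) ->
  (forall g, g \in G -> exists2 a, a \in H & a.2 = g) ->
  H / 'ker_H projm \isog G.
Proof.
move=> HG GH; have <- : projm @* H = G; last by rewrite first_isog_loc ?subsetT.
apply/setP=> g; apply/morphimP/idP => [[a _ Ha ->]|/GH[a Ha <-]].
  exact: HG.
by exists a; rewrite ?inE.
Qed.

End ElementaryKernel.

(** Such a [g] is a square, hence even. *)
Lemma odd_expg_Alt (T : finType) (g : {perm T}) n :
  odd n -> g ^+ n = 1 -> g \in 'Alt_T.
Proof.
move=> on gn; have -> : g = g ^+ (n.+1)./2 * g ^+ (n.+1)./2.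
  by rewrite -expgD addnn even_halfK ?expgSr ?gn ?mul1g //= on.
by rewrite Alt_even odd_permM addbb.
Qed.

(** * Decorated pairs of distinct points *)

Section OffDiagonal.

Variables (A : finZmodType) (T : finType).

Definition offdiag : {set T * T * A} := [set z | z.1.1 != z.1.2].

Lemma card_offdiag : #|offdiag| = (#|T| * #|T|.-1 * #|A|)%N.
Proof.
have -> : offdiag = setX [set z : T * T | z.1 != z.2] [set: A].
  by apply/setP=> z; rewrite !inE andbT.
rewrite cardsX cardsT; congr muln.
have := cardsC [set z : T * T | z.1 == z.2].
have -> : #|[set z : T * T | z.1 == z.2]| = #|T|.
  have -> : [set z : T * T | z.1 == z.2] = [set (i, i) | i in [set: T]].
    apply/setP=> -[i j]; rewrite inE /=; apply/eqP/imsetP => [->|[l _ [-> ->]]] //.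
    by exists j; rewrite ?inE.
  by rewrite card_imset ?cardsT // => i j [].
have -> : ~: [set z : T * T | z.1 == z.2] = [set z : T * T | z.1 != z.2].
  by apply/setP=> z; rewrite !inE.
rewrite card_prod => /(congr1 (subn^~ #|T|)); rewrite addKn => ->.
by rewrite -subn1 mulnBr muln1.
Qed.

Lemma acts_offdiag (H : {set pair_wr A T}) :
  [acts H, on offdiag | pair_wr_action A T].
Proof.
apply/subsetP=> a _; rewrite !inE; apply/subsetP=> z.
by rewrite !inE (inj_eq perm_inj).
Qed.

End OffDiagonal.

(** * The extension by a 2-group *)

Section BinaryExtension.

Variable k : nat.
Hypothesis k_gt3 : (3 < k)%N.

Let T := 'I_k.
Let F := 'F_2.

(* The right-hand side is the cocycle that corresponds, by Shapiro's lemma, to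
   the sign of the action of the stabiliser of [{i, j}] on [{i, j}]. *)
Definition order_ext_set : {set pair_wr F T} :=
  [set a : pair_wr F T | [&& a.2 \in 'Alt_T, [forall i, a.1 (i, i) == 0%R]
   & [forall i, forall j,
      (a.1 (i, j) + a.1 (j, i) == (a.2 i < a.2 j)%N%:R - (i < j)%N%:R)%R]]].

Lemma order_extP (a : pair_wr F T) :
  reflect [/\ a.2 \in 'Alt_T, forall i, a.1 (i, i) = 0%R
    & forall i j : T,
      (a.1 (i, j) + a.1 (j, i) = (a.2 i < a.2 j)%N%:R - (i < j)%N%:R)%R]
    (a \in order_ext_set).
Proof.
rewrite [a \in order_ext_set]inE; apply: (iffP and3P); move=> [aA a0 ao]; split=> //.
- by move=> i; apply/eqP/(forallP a0).
- by move=> i j; apply/eqP; move/forallP/(_ i)/forallP: ao.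
- by apply/forallP=> i; rewrite a0.
- by apply/forallP=> i; apply/forallP=> j; rewrite ao.
Qed.

(** The right-hand side is the change of the indicator of [i < j] under the permutation, so it
    telescopes along products. *)
Fact order_ext_group_set : group_set order_ext_set.
Proof.
apply/group_setP; split.
  apply/order_extP; split=> [|i|i j]; rewrite ?group1 ?ffunE //.
  by rewrite !perm1 subrr addr0.
move=> a b /order_extP[aA a0 ao] /order_extP[bA b0 bo].
apply/order_extP; split=> [|i|i j]; first by rewrite groupM.
  by rewrite pair_wrME a0 b0 addr0.
by rewrite !pair_wrME addrACA ao bo /= !permM addrC addrA subrK.
Qed.

Canonical order_ext := Group order_ext_group_set.

Lemma order_ext_lift g :
  g \in 'Alt_T -> exists2 a, a \in order_ext & a.2 = g.
Proof.
(* The whole required sum is placed on the pairs with [i < j]; for [j < i] the two sides then agree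
   because [-1 = 1] in [F]. *)
move=> gA; exists ([ffun z : T * T =>
  if (z.1 < z.2)%N then (g z.1 < g z.2)%N%:R - 1 else 0 : F]%R, g) => //.
apply/order_extP; split=> //= [i|i j]; rewrite !ffunE ?ltnn //=.
case: (ltngtP i j) => [ltij|ltji|/val_inj->].
- by rewrite addr0.
- have: g i != g j by rewrite (inj_eq perm_inj) -val_eqE /= gtn_eqF.
  by rewrite -val_eqE add0r /=; case: ltngtP => // _ _; apply/eqP.
- by rewrite !ltnn addr0 subrr.
Qed.

Let projm := pair_wr_proj_morphism F T.

(** Translates every decoration by [c]: a non-trivial kernel element for [c = 1], and the means to
    reach all decorations in the proof of transitivity. *)
Definition offdiag_const (c : F) : pair_wr F T :=
  ([ffun z => if z.1 == z.2 then 0%R else c], 1).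

Lemma offdiag_const_ker c : offdiag_const c \in 'ker_order_ext projm.
Proof.
apply/pair_wr_kerP; split=> //.
apply/order_extP; split=> [|i|i j]; rewrite /= ?group1 ?ffunE ?eqxx //=.
rewrite !perm1 subrr eq_sym; case: ifP => _; first by rewrite addr0.
exact: addrr_pchar2 (pchar_Fp _) _.
Qed.

Lemma order_ext_ker_neq1 : 'ker_order_ext projm != 1.
Proof.
apply/trivgPn; exists (offdiag_const 1%R); first exact: offdiag_const_ker.
pose o0 : T := Ordinal (ltn_trans (isT : 0 < 3) k_gt3).
pose o1 : T := Ordinal (ltn_trans (isT : 1 < 3) k_gt3).
apply/eqP=> /(congr1 (fun a : pair_wr F T => a.1 (o0, o1))).
by rewrite !ffunE => /eqP.
Qed.

(* Every lift of the involution [(0 1)(2 3)] has order divisible by 4. *)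
Lemma order_ext_nonsplit : ~~ [splits order_ext, over 'ker_order_ext projm].
Proof.
apply/negP=> spl.
pose o0 : T := Ordinal (ltn_trans (isT : 0 < 3) k_gt3).
pose o1 : T := Ordinal (ltn_trans (isT : 1 < 3) k_gt3).
pose o2 : T := Ordinal (ltn_trans (isT : 2 < 3) k_gt3).
pose o3 : T := Ordinal k_gt3.
(* The second transposition only makes [g] even. *)
pose g : {perm T} := tperm o0 o1 * tperm o2 o3.
have g0 : g o0 = o1 by rewrite permM tpermL tpermD.
have g1 : g o1 = o0 by rewrite permM tpermR tpermD.
have g2 : g ^+ 2 = 1.
  have tC : commute (tperm o0 o1) (tperm o2 o3).
    by apply/commgP/conjg_fixP; rewrite tpermJ !tpermD.
  by rewrite expgMn // !expgS !expg0 !mulg1 !tperm2 mulg1.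
have gA : g \in 'Alt_T by rewrite Alt_even odd_permM !odd_tperm.
have [a Ha ag] := order_ext_lift gA.
have [|y [/order_extP[_ _ yo] yg y2]] := splits_ker_lift (n := 2) spl Ha.
  by rewrite /= /pair_wr_proj ag.
have {}yg : y.2 = g by rewrite -ag.
(* As [g] swaps [o0] and [o1], the value of [y ^+ 2] at [(o0, o1)] is
   [y.1 (o0, o1) + y.1 (o1, o0) = 0 - 1], which is nonzero. *)
have /(congr1 (fun a : pair_wr F T => a.1 (o0, o1))) := y2.
rewrite expgS expg1 pair_wrME yg g0 g1 yo yg g0 g1 ffunE /=.
by move/eqP.
Qed.

Let to := pair_wr_action F T.

(** The action on [offdiag] does not see the diagonal values of [a.1]; the group requires them to be
    zero. *)
Lemma order_ext_faithful : [faithful order_ext, on offdiag F T | to].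
Proof.
apply/subsetP=> a /setIP[/order_extP[_ a0 _]] /astabP fixa.
have fixij i j : i != j -> a.2 i = i /\ a.1 (i, j) = 0%R.
  move=> ij; have /fixa : (i, j, 0%R : F) \in offdiag F T by rewrite inE.
  by case/pair_wr_act_fix.
apply/set1gP/injective_projections; last first.
  apply/permP=> i; rewrite perm1.
  have /card_gt1P[x [y [_ _ xy]]] : (1 < #|T|)%N.
    by rewrite card_ord (ltn_trans _ k_gt3).
  have [ix|/fixij[]//] := eqVneq i x.
  by rewrite -ix in xy; case: (fixij _ _ xy).
apply/ffunP=> -[i j]; rewrite ffunE.
by have [<-|/fixij[]//] := eqVneq i j; rewrite a0.
Qed.

Lemma order_ext_transitive : [transitive order_ext, on offdiag F T | to].
Proof.
have k2 : (2 <= #|T|.-2)%N by rewrite card_ord; case: (k) k_gt3 => [|[|[|[|]]]].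
(* The alternating group is [(k - 2)]-transitive, hence 2-transitive. *)
have tr2 := ntransitive_weak k2 (Alt_trans T).
pose o0 : T := Ordinal (ltn_trans (isT : 0 < 3) k_gt3).
pose o1 : T := Ordinal (ltn_trans (isT : 1 < 3) k_gt3).
have dt (i j : T) : i != j -> [tuple i; j] \in 2.-dtuple([set: T]).
  by move=> ij; rewrite inE /= inE ij; apply/subsetP=> ?; rewrite inE.
pose z0 : T * T * F := (o0, o1, 0%R).
apply/imsetP; exists z0; first by rewrite inE.
apply/setP=> -[[i j] x]; rewrite inE /=; apply/idP/orbitP => [ij|[a Ha [<- <- _]]].
  have [g gA [gi gj]] := atransP2 tr2 (dt o0 o1 isT) (dt i j ij).
  have [a Ha ag] := order_ext_lift gA.
  (* The lift [a] sends [z0] to [(i, j, a.1 (o0, o1))]; [c] corrects the decoration to [x]. *)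
  pose c := (x - a.1 (o0, o1))%R.
  exists (offdiag_const c * a).
    by rewrite groupM //; have /pair_wr_kerP[] := offdiag_const_ker c.
  by rewrite /= /pair_wr_act pair_wrME /= ffunE /= !permM !perm1 ag add0r subrK gi gj.
by rewrite (inj_eq perm_inj).
Qed.

End BinaryExtension.

(** * Decorated pairs up to reversal with change of sign *)

Section FlipOrbits.

Variables (A : finZmodType) (T : finType).

Definition pair_flip (z : T * T * A) : T * T * A := (z.1.2, z.1.1, - z.2)%R.

Lemma pair_flipK : involutive pair_flip.
Proof. by case=> -[i j] x; rewrite /pair_flip /= opprK. Qed.

Definition flip_orbit (z : T * T * A) : {set T * T * A} := [set z; pair_flip z].

Definition flip_orbits : {set {set T * T * A}} := flip_orbit @: offdiag A T.

Lemma flip_orbit_eq z1 z2 : (flip_orbit z1 == flip_orbit z2) = (z1 \in flip_orbit z2).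
Proof.
apply/eqP/idP => [<-|/set2P[]-> //]; first exact: set21.
by rewrite /flip_orbit pair_flipK setUC.
Qed.

(** Off the diagonal [pair_flip] changes the first point, so it has no fixed points and each class
    has two elements. *)
Lemma card_flip_orbits : (2 * #|flip_orbits|)%N = #|offdiag A T|.
Proof.
rewrite -[RHS]sum1_card (partition_big_imset flip_orbit) /=.
rewrite mulnC -sum_nat_const; apply: eq_bigr => _ /imsetP[z Dz ->].
under eq_bigl => y do rewrite flip_orbit_eq.
have zF : z != pair_flip z.
  by apply/eqP=> /(congr1 (fun z => z.1.1)) /eqP; rewrite inE in Dz; apply/negP.
rewrite sum1dep_card -[2]/((true : nat).+1) -zF -cards2.
apply: eq_card => y; rewrite [RHS]inE andb_idl // => /set2P[] -> //.
by move: Dz; rewrite !inE eq_sym.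
Qed.

Let to := pair_wr_action A T.

Lemma pair_wr_act_flip (a : pair_wr A T) z :
  (forall i j, a.1 (j, i) = - a.1 (i, j))%R -> to (pair_flip z) a = pair_flip (to z a).
Proof.
by case: z => -[i j] x aC; rewrite /= /pair_wr_act /pair_flip /= aC opprD.
Qed.

Lemma flip_orbit_act (a : pair_wr A T) z :
  (forall i j, a.1 (j, i) = - a.1 (i, j))%R ->
  (to^*)%act (flip_orbit z) a = flip_orbit (to z a).
Proof.
by move=> aC; rewrite /flip_orbit /= /setact imsetU1 imset_set1 pair_wr_act_flip.
Qed.

End FlipOrbits.

(** * The extension for odd [p] *)

Section OddExtension.

Variables (p : nat) (T : finType) (o : T).
Hypotheses (p_pr : prime p) (p_odd : odd p).

Let F := 'F_p.
Let projm := pair_wr_proj_morphism F T.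

(* [[g i = o] - [i = o]] is a coboundary in the permutation module, but not in
   its sum-zero submodule when [p] divides [#|T|]. *)
Definition alt_ext_set : {set pair_wr F T} :=
  [set a : pair_wr F T | [&& a.2 \in 'Alt_T,
     [forall i, forall j, a.1 (j, i) == (- a.1 (i, j))%R]
   & [forall i,
      \sum_j a.1 (i, j) == (a.2 i == o)%:R - (i == o)%:R]%R]].

Lemma alt_extP (a : pair_wr F T) :
  reflect [/\ a.2 \in 'Alt_T, forall i j, a.1 (j, i) = (- a.1 (i, j))%R
    & forall i, (\sum_j a.1 (i, j) = (a.2 i == o)%:R - (i == o)%:R)%R]
    (a \in alt_ext_set).
Proof.
rewrite [a \in alt_ext_set]inE; apply: (iffP and3P); move=> [aA aC ao]; split=> //.
- by move=> i j; apply/eqP; move/forallP/(_ i)/forallP: aC.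
- by move=> i; apply/eqP/(forallP ao).
- by apply/forallP=> i; apply/forallP=> j; rewrite aC.
- by apply/forallP=> i; rewrite ao.
Qed.

Fact alt_ext_group_set : group_set alt_ext_set.
Proof.
apply/group_setP; split.
  apply/alt_extP; split=> [|i j|i]; rewrite ?group1 ?ffunE ?oppr0 //.
  by rewrite perm1 subrr big1 // => j _; rewrite ffunE.
move=> a b /alt_extP[aA aC ao] /alt_extP[bA bC bo].
apply/alt_extP; split=> [|i j|i]; first by rewrite groupM.
  by rewrite !pair_wrME /= aC bC opprD.
under eq_bigr do rewrite pair_wrME /=.
(* Row [i] of the translate of [b.1] is row [a.2 i] of [b.1], reindexed; the right-hand sides then
   telescope. *)
rewrite big_split /= ao (reindex_inj (@perm_inj _ a.2^-1)) /=.
under [X in (_ + X)%R]eq_bigr do rewrite permKV.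
by rewrite bo permM addrC addrA subrK.
Qed.

Canonical alt_ext := Group alt_ext_group_set.

(** The oriented edge from [x] to [y]; taking row sums is, up to sign, the boundary map. *)
Definition wedge (x y : T) : {ffun T * T -> F} :=
  [ffun z => (z == (x, y))%:R - (z == (y, x))%:R]%R.

Lemma wedgeC x y i j : wedge x y (j, i) = (- wedge x y (i, j))%R.
Proof.
rewrite !ffunE opprB !xpair_eqE.
by rewrite (andbC (j == x)) (andbC (j == y)).
Qed.

Lemma sum_wedge x y i : (\sum_j wedge x y (i, j) = (i == x)%:R - (i == y)%:R)%R.
Proof.
have sum_delta u w : (\sum_j ((i, j) == (u, w))%:R = (i == u)%:R :> F)%R.
  rewrite (bigD1 w) //= big1 ?addr0 ?xpair_eqE ?eqxx ?andbT // => j /negPf jw.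
  by rewrite xpair_eqE jw andbF.
under eq_bigr do rewrite ffunE.
by rewrite sumrB !sum_delta.
Qed.

Lemma alt_ext_lift g : g \in 'Alt_T -> exists2 a, a \in alt_ext & a.2 = g.
Proof.
(* The row sums of this edge are [[i = g^-1 o] - [i = o]], and [i = g^-1 o] means [g i = o]. *)
move=> gA; exists (wedge (g^-1 o) o, g) => //.
apply/alt_extP; split=> //= [i j|i]; first exact: wedgeC.
by rewrite sum_wedge -(inj_eq (@perm_inj _ g)) permKV.
Qed.

Hypothesis T_gt2 : (2 < #|T|)%N.

Lemma alt_ext_ker_neq1 : 'ker_alt_ext projm != 1.
Proof.
have /card_gt2P[x [y [z [_ [xy yz zx]]]]] := T_gt2.
(* An oriented triangle is a cycle, so its row sums vanish; its value at [(x, y)] is 1. *)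
pose v := [ffun u => wedge x y u + wedge y z u + wedge z x u]%R.
have vE u : (v u = wedge x y u + wedge y z u + wedge z x u)%R by rewrite ffunE.
apply/trivgPn; exists ((v, 1) : pair_wr F T).
  apply/pair_wr_kerP; split=> //; apply/alt_extP; split=> /= [|i j|i].
  - exact: group1.
  - by rewrite !vE !(wedgeC _ _ i j) !opprD.
  rewrite perm1 subrr; under eq_bigr do rewrite vE.
  rewrite !big_split /= !sum_wedge.
  by rewrite [X in (X + _)%R]addrA subrK addrA subrK subrr.
apply/eqP=> /(congr1 (fun a : pair_wr F T => a.1 (x, y))).
rewrite !ffunE !xpair_eqE !eqxx (negPf xy) (negPf yz).
rewrite (eq_sym x z) (negPf zx) /=.
by rewrite ?subr0 ?addr0 => /eqP; rewrite oner_eq0.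
Qed.

Lemma two_neq0 : (2%:R != 0 :> F)%R.
Proof.
rewrite -(dvdn_pcharf (pchar_Fp p_pr)) dvdn_prime2 //.
by apply: contraTneq p_odd => ->.
Qed.

(* If a lift [y] of [g] had [y ^+ p = 1], then all sums of [y.1] over
   [g]-orbits of pairs would vanish, hence also the sum of
   [(phi i - phi j) * y.1 (i, j)], whose first factor is constant on these
   orbits; but the row sums of [y.1] force its value to be [-2]. *)
Lemma alt_ext_nonsplit (g : {perm T}) (phi : T -> F) :
  g ^+ p = 1 -> (forall i, phi (g i) = phi i + 1)%R ->
  ~~ [splits alt_ext, over 'ker_alt_ext projm].
Proof.
move=> gp phig; apply/negP=> spl.
have [a Ha ag] := alt_ext_lift (odd_expg_Alt p_odd gp).
have [|y [/alt_extP[_ yC yo] yg yp]] := splits_ker_lift (n := p) spl Ha.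
  by rewrite /= /pair_wr_proj ag.
have {}yg : y.2 = g by rewrite -ag.
rewrite yg in yo.
pose W := (\sum_i \sum_j (phi i - phi j) * y.1 (i, j))%R.
have phigX m i : (phi ((g ^+ m)%g i) = phi i + m%:R)%R.
  elim: m => [|m IHm]; first by rewrite perm1 addr0.
  by rewrite expgSr permM phig IHm -addrA natr1.
have W0 : W = 0%R.
  rewrite /W (partition_big phi xpredT) //=.
  (* Each pair is moved by [g ^+ m], with [m] the value of [phi] at its first point, from a unique
     pair whose first point has [phi = 0]. *)
  transitivity (\sum_(m : F) \sum_(i | phi i == 0) \sum_j
      - phi j * y.1 ((g ^+ m)%g i, (g ^+ m)%g j))%R.
    apply: eq_bigr => m _; rewrite (reindex_inj (@perm_inj _ (g ^+ m)%g)) /=.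
    apply: eq_big => [i|i /eqP i0].
      by rewrite phigX natr_Zp -subr_eq0 addrK.
    rewrite (reindex_inj (@perm_inj _ (g ^+ m)%g)) /=.
    apply: eq_bigr => j _; rewrite i0 phigX natr_Zp.
    by rewrite opprD addrC subrK.
  rewrite exchange_big big1 // => i _; rewrite exchange_big big1 // => j _.
  rewrite -mulr_sumr.
  (* A sum over [m : F] is a sum over ordinals below this bound, which equals [p]. *)
  have yF : y ^+ (Zp_trunc (pdiv p)).+2 = 1 by rewrite Fp_cast.
  have /(congr1 (fun a : pair_wr F T => a.1 (i, j))) := yF.
  by rewrite pair_wrXE yg ffunE => ->; rewrite mulr0.
pose Y := (\sum_i phi i * \sum_j y.1 (i, j))%R.
have WY : W = (Y + Y)%R.
  have -> : W = (Y - \sum_i \sum_j phi j * y.1 (i, j))%R.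
    rewrite -sumrB; apply: eq_bigr => i _; rewrite mulr_sumr -sumrB.
    by apply: eq_bigr => j _; rewrite mulrBl.
  congr (_ + _)%R; rewrite exchange_big -sumrN; apply: eq_bigr => j _.
  rewrite -mulr_sumr -mulrN -sumrN; congr (_ * _)%R; apply: eq_bigr => i _.
  by rewrite yC opprK.
(* By the row sums, [Y = phi (g^-1 o) - phi o]. *)
have Y1 : Y = (-1)%R.
  have sum_delta (f : T -> F) : (\sum_i f i * (i == o)%:R = f o)%R.
    rewrite (bigD1 o) //= eqxx mulr1 big1 ?addr0 // => i /negPf->.
    by rewrite mulr0.
  rewrite /Y; under eq_bigr => i _ do rewrite yo mulrBr.
  rewrite sumrB sum_delta (reindex_inj (@perm_inj _ g^-1)) /=.
  under eq_bigr do rewrite permKV.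
  by rewrite sum_delta -{2}(permKV g o) phig opprD addrA subrr add0r.
move: W0; rewrite WY Y1 -opprD => /eqP; rewrite oppr_eq0.
by rewrite (negPf two_neq0).
Qed.

Let to := pair_wr_action F T.

Lemma acts_flip_orbits : [acts alt_ext, on flip_orbits F T | to^*].
Proof.
apply/subsetP=> a /alt_extP[_ aC _]; rewrite !inE; apply/subsetP=> _ /imsetP[z Dz ->].
rewrite inE flip_orbit_act // imset_f //.
by rewrite [_ \in _](acts_act (acts_offdiag _) (in_setT a)).
Qed.

Lemma alt_ext_faithful : [faithful alt_ext, on flip_orbits F T | to^*].
Proof.
apply/subsetP=> a /setIP[/alt_extP[_ aC _]] /astabP fixa.
have fixij i j (x : F) : i != j -> to (i, j, x) a \in flip_orbit (i, j, x).
  move=> ij; rewrite -flip_orbit_eq -flip_orbit_act //; apply/eqP/fixa.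
  by rewrite imset_f // inE.
have aij i j : i != j -> (a.2 i == i) || (a.2 i == j).
  move=> ij; have /set2P[] := fixij i j 0%R ij
    => /(congr1 (fun z => z.1.1)) /= ->; rewrite eqxx //.
  by rewrite orbT.
(* For distinct [x], [y] other than [i], the image of [i] lies in both [{i, x}] and [{i, y}]. *)
have a1 i : a.2 i = i.
  have T_gt1 : (1 < #|[set: T] :\ i|)%N.
    by move: T_gt2; rewrite -cardsT (cardsD1 i) inE.
  have /card_gt1P[x [y [/setD1P[xi _] /setD1P[yi _] xy]]] := T_gt1.
  apply/eqP; apply: contraNT xy => ai.
  move: (aij i x) (aij i y); rewrite !(eq_sym i) xi yi (negPf ai) /=.
  by move=> /(_ isT)/eqP <- /(_ isT).
apply/set1gP/injective_projections; last by apply/permP=> i; rewrite perm1.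
apply/ffunP=> -[i j]; rewrite ffunE.
have [<-|ij] := eqVneq i j.
  (* Antisymmetry gives [2 * a.1 (i, i) = 0], and 2 is invertible. *)
  have := aC i i; move/eqP; rewrite -subr_eq0 opprK -mulr2n -mulr_natl mulf_eq0.
  by rewrite (negPf two_neq0) => /eqP.
have /set2P[|/(congr1 (fun z => z.1.1))] := fixij i j 0%R ij.
  by case/pair_wr_act_fix.
by rewrite /= a1 => /eqP; rewrite (negPf ij).
Qed.

End OddExtension.

(** Rotates each block of [p] consecutive points one step; reduction mod [p] then serves as the
    function [phi] of [alt_ext_nonsplit]. *)
Lemma block_rotation (p k : nat) : (0 < p)%N -> (p %| k)%N ->
  exists2 g : {perm 'I_k}, g ^+ p = 1 & forall i : 'I_k, g i = i.+1 %[mod p].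
Proof.
move=> p_gt0 /dvdnP[d ->].
have rot_lt (i : 'I_(d * p)) m : (i %/ p * p + (i + m) %% p < d * p)%N.
  have : (i %/ p < d)%N by rewrite ltn_divLR.
  rewrite -(leq_pmul2r p_gt0) => /(leq_trans _); apply.
  by rewrite mulSn addnC ltn_add2r ltn_mod.
pose r m i := Ordinal (rot_lt i m).
have rD m n i : r m (r n i) = r (n + m)%N i.
  apply: val_inj => /=.
  rewrite divnMDl // (divn_small (ltn_pmod _ p_gt0)) addn0.
  by congr (_ + _)%N; rewrite -addnA modnMDl modnDml addnA.
have r0 i : r p i = i.
  by apply: val_inj; rewrite /= modnDr -divn_eq.
have r_inj : injective (r 1%N).
  apply: (can_inj (g := r p.-1)) => i.
  by rewrite rD add1n prednK.
exists (perm r_inj) => [|i]; last by rewrite permE /= modnMDl modn_mod addn1.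
apply/permP=> i; rewrite perm1 -[RHS]r0 permX.
have E m : iter m (perm r_inj) i = r m i.
  elim: m => [|m IHm] /=; last by rewrite IHm permE rD addn1.
  by apply: val_inj; rewrite /= addn0 -divn_eq.
exact: E.
Qed.

(** * The two extensions of [A_k] and their degrees *)

Theorem theorem1p2 (k p : nat) (hk : (10 <= k)%N) (hp : prime p) :
  (odd p -> (p %| k)%N ->
    exists (gT : finGroupType) (H M : {group gT}),
      [/\ p.-abelem M, M :!=: 1 & M <| H] /\
      [/\ (H / M) \isog ('Alt_('I_k) : {set {perm 'I_k}}),
          ~~ [splits H, over M]
        & faithful_perm_rep H (p * k * (k - 1) %/ 2)%N])
  /\
  (exists (gT : finGroupType) (H M : {group gT}),
      [/\ 2.-abelem M, M :!=: 1 & M <| H] /\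
      [/\ (H / M) \isog ('Alt_('I_k) : {set {perm 'I_k}}),
          ~~ [splits H, over M]
        & faithful_transitive_perm_rep H (2 * k * (k - 1))%N]).
Proof.
split=> [p_odd p_dvd_k|].
  have k_gt2 : (2 < #|'I_k|)%N by rewrite card_ord (leq_trans _ hk).
  pose o : 'I_k := Ordinal (leq_trans (isT : 0 < 10) hk).
  pose H := alt_ext p o.
  exists (pair_wr 'F_p 'I_k), H, ('ker_H (pair_wr_proj_morphism 'F_p 'I_k))%G.
  split; split.
  - exact: pair_wr_ker_abelem.
  - exact: alt_ext_ker_neq1.
  - exact: pair_wr_ker_normal.
  - apply: pair_wr_quotient_isog => [a /alt_extP[] //|g].
    exact: alt_ext_lift.
  - have [g gp gS] := block_rotation (prime_gt0 hp) p_dvd_k.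
    have phiS i : ((g i)%:R = i%:R + 1 :> 'F_p)%R.
      by rewrite natr1 -[LHS](Fp_nat_mod hp) gS Fp_nat_mod.
    exact: (alt_ext_nonsplit o hp p_odd gp phiS).
  - have -> : (p * k * (k - 1) %/ 2)%N = #|flip_orbits 'F_p 'I_k|.
      have := card_flip_orbits 'F_p 'I_k.
      rewrite card_offdiag card_ord card_Fp // mulnC => E.
      by rewrite -mulnA subn1 mulnC -E mulnK.
    apply: faithful_perm_rep_action (acts_flip_orbits _ _) _.
    exact: alt_ext_faithful.
have k_gt3 : (3 < k)%N by rewrite (leq_trans _ hk).
pose H := order_ext k.
exists (pair_wr 'F_2 'I_k), H, ('ker_H (pair_wr_proj_morphism 'F_2 'I_k))%G.
split; split.
- exact: pair_wr_ker_abelem.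
- exact: order_ext_ker_neq1.
- exact: pair_wr_ker_normal.
- apply: pair_wr_quotient_isog => [a /order_extP[] //|g].
  exact: order_ext_lift.
- exact: order_ext_nonsplit.
- have -> : (2 * k * (k - 1))%N = #|offdiag 'F_2 'I_k|.
    by rewrite card_offdiag card_ord card_Fp // subn1 -mulnA mulnC.
  apply: faithful_transitive_perm_rep_action (acts_offdiag _) _ _.
    exact: order_ext_faithful.
  exact: order_ext_transitive.
Qed.
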